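(* Let $Y$ be a rich solid QBF-space on $X$ and let the analyzing frame $\mathcal F=\{\varphi_x\}_{x\in X}$ possess property $F(\nu,Y)$. Further, let $\mathcal G=\{\psi_x\}_{x\in X}$ be a family in $\mathcal H$ and $\mathcal U=\{U_i\}_{i\in I}$ an admissible covering of $X$ such that $K_{\mathcal U}:=K_{\mathcal U}[\mathcal G,\mathcal F]$ defines a bounded operator on $Y$. Then for $\{\lambda_i\}_{i\in I}\in Y^\natural(\mathcal U)$ and for points $x_i\in U_i$ the series $\sum_{i\in I}\lambda_i\psi_{x_i}$ converges unconditionally in the weak*-topology of $(\mathcal H_1^\nu)^\urcorner$ to an element $f\in\mathrm{Co}(\mathcal F,Y)$ with $$V_{\mathcal F}f=V_{\mathcal F}\Big(\sum_{i\in I}\lambda_i\psi_{x_i}\Big)=\sum_{i\in I}\lambda_iV_{\mathcal F}\psi_{x_i}$$ and the estimate $$\|f|\mathrm{Co}(\mathcal F,Y)\|=\Big\|\sum_{i\in I}\lambda_i\psi_{x_i}\Big|\mathrm{Co}(\mathcal F,Y)\Big\|\le\|K_{\mathcal U}|Y\to Y\|\,\|\{\lambda_i\}_{i\in I}|Y^\natural(\mathcal U)\| .$$ Moreover, if the finite sequences are dense in $Y^\natural(\mathcal U)$ the series also converges unconditionally in the quasi-norm of $\mathrm{Co}(\mathcal F,Y)$.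
   Context: Frame setting. $\mathcal H$ is a separable complex Hilbert space (inner product linear in the first argument); $X$ is a $\sigma$-compact locally compact Hausdorff space with a positive Radon measure $\mu$, $\operatorname{supp}\mu=X$. $\mathcal F=\{\varphi_x\}_{x\in X}\subset\mathcal H$ is a Parseval continuous frame: $x\mapsto\varphi_x$ is weakly measurable and $\|f|\mathcal H\|^2=\int_X|\langle f,\varphi_x\rangle|^2\,d\mu(x)$ for all $f\in\mathcal H$. $V_{\mathcal F}f(x)=\langle f,\varphi_x\rangle$; $R_{\mathcal F}(x,y)=\langle\varphi_y,\varphi_x\rangle$. A measurable kernel $K:X\times X\to\mathbb C$ acts by $K(F)(x)=\int_XK(x,y)F(y)\,d\mu(y)$. Weights. For a weight (measurable function) $\nu:X\to[1,\infty)$: $\|F|L_p^\nu\|=\|F\nu|L_p(X,\mu)\|$, $m_\nu(x,y)=\max\{\nu(x)/\nu(y),\nu(y)/\nu(x)\}$; $\mathcal A_{m_\nu}$ is the set of measurable $K$ with $\max\{\operatorname{ess\,sup}_x\int|K(x,y)|m_\nu(x,y)d\mu(y),\operatorname{ess\,sup}_y\int|K(x,y)|m_\nu(x,y)d\mu(x)\}<\infty$. $\mathcal H_1^\nu=\{f\in\mathcal H:V_{\mathcal F}f\in L_1^\nu(X)\}$ with norm $\|V_{\mathcal F}f|L_1^\nu\|$; $(\mathcal H_1^\nu)^\urcorner$ is its normed anti-dual (bounded conjugate-linear functionals), with duality product $\langle\cdot,\cdot\rangle$ extending the inner product of $\mathcal H$, so $\mathcal H\hookrightarrow(\mathcal H_1^\nu)^\urcorner$.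 Frame condition: (a) $\|\varphi_x|\mathcal H\|\le C_B\nu(x)$ for some $C_B>0$ and all $x\in X$; (b) $R_{\mathcal F}\in\mathcal A_{m_\nu}$. By convention $\mathcal F\subset\mathcal H_1^\nu$ is assumed, and $V_{\mathcal F}f(x)=\langle f,\varphi_x\rangle$ for $f\in(\mathcal H_1^\nu)^\urcorner$. Function spaces. A QBF-space $Y$ on $X$ is a linear space of ($\mu$-a.e. equivalence classes of) measurable functions on $X$, complete under a quasi-norm. It is solid if $f$ measurable, $g\in Y$, $|f|\le|g|$ a.e. imply $f\in Y$, $\|f|Y\|\le\|g|Y\|$; rich if $\chi_K\in Y$ for all compact $K\subset X$. Property $F(\nu,Y)$ (for a weight $\nu\ge1$): $\mathcal F$ satisfies (a),(b), $R_{\mathcal F}:Y\to Y$ is continuous, and $R_{\mathcal F}(Y)\hookrightarrow L_\infty^{1/\nu}(X)$ continuously. Then $\mathrm{Co}(\mathcal F,Y)=\{f\in(\mathcal H_1^\nu)^\urcorner:V_{\mathcal F}f\in Y\}$, $\|f|\mathrm{Co}(\mathcal F,Y)\|=\|V_{\mathcal F}f|Y\|$. Coverings and kernels. A covering $\mathcal U=\{U_i\}_{i\in I}$ of $X$ is admissible if it is locally finite (each $x\in X$ has a neighborhood meeting only finitely many $U_i$), each $U_i$ is measurable, relatively compact, with non-void interior, and $\sup_{i}\sharp\{j:U_i\cap U_j\ne\emptyset\}<\infty$. $Y^\natural(\mathcal U)$ is the space of complex sequences with finite quasi-norm $\|\{\lambda_i\}|Y^\natural\|=\|\sum_i|\lambda_i|\mu(U_i)^{-1}\chi_{U_i}|Y\|$.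 With $Q_y=\bigcup_{i:y\in U_i}U_i$: $K_{\mathcal U}[\mathcal G,\mathcal F](x,y)=\sup_{z\in Q_y}|\langle\varphi_x,\psi_z\rangle|$. *)

(* Defs.v *)
From HB Require Import structures.
From mathcomp Require Import all_boot all_order all_algebra finmap.
From mathcomp Require Import all_classical all_reals all_analysis.
From mathcomp Require Import ess_sup_inf complex.
From mathcomp Require Export summability.

Set Implicit Arguments.
Unset Strict Implicit.
Unset Printing Implicit Defensive.

Import Order.TTheory GRing.Theory Num.Theory.
Import numFieldNormedType.Exports.

Local Open Scope classical_set_scope.
Local Open Scope ring_scope.
Local Open Scope complex_scope.

Local Notation normc := Normc.normc.

Notation borel X := (g_sigma_algebraType (@open X)).

Section complex_integral.
Context d (T : measurableType d) (R : realType).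
Variable mu : {measure set T -> \bar R}.

Definition cmeasurable (f : T -> R[i]) : Prop :=
  measurable_fun [set: T] (fun x => complex.Re (f x)) /\
  measurable_fun [set: T] (fun x => complex.Im (f x)).

Definition cintegrable (f : T -> R[i]) : Prop :=
  mu.-integrable [set: T] (fun x => (complex.Re (f x))%:E) /\
  mu.-integrable [set: T] (fun x => (complex.Im (f x))%:E).

Definition cintegral (f : T -> R[i]) : R[i] :=
  (\int[mu]_x complex.Re (f x))%R +i* (\int[mu]_x complex.Im (f x))%R.

End complex_integral.

Section radon.
Context (R : realType) (X : ptopologicalType).
Variable mu : {measure set (borel X) -> \bar R}.

Definition radon_measure : Prop :=
  [/\ forall K : set X, compact K -> (mu K < +oo)%E,
      forall A : set X, measurable (A : set (borel X)) ->
        mu A = ereal_inf [set mu O | O in [set O : set X | open O /\ A `<=` O]] &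
      forall O : set X, open O ->
        mu O = ereal_sup [set mu K | K in [set K : set X | compact K /\ K `<=` O]]].

Definition supp : set X :=
  [set x | forall O : set X, open O -> O x -> (0 < mu O)%E].

End radon.

Definition sigma_compact (X : topologicalType) : Prop :=
  exists K : nat -> set X,
    (forall n, compact (K n)) /\ \bigcup_n K n = [set: X].

Definition separable (H : topologicalType) : Prop :=
  exists D : set H, countable D /\ dense D.

Section qbf.
Context (R : realType) (X : ptopologicalType).
Variable mu : {measure set (borel X) -> \bar R}.

(* A space of classes modulo equality a.e. is encoded by the set of its
   representatives, saturated for a.e. equality of measurable functions.
   The value of qnorm is irrelevant outside of qmem. *)
Record qbfSpace := QBFSpace {
  qmem : set (X -> R[i]) ;
  qnorm : (X -> R[i]) -> R ;
  qmem_measurable : forall f, qmem f -> cmeasurable (f : borel X -> R[i]) ;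
  qmem_ae : forall f g, qmem f -> cmeasurable (g : borel X -> R[i]) ->
    {ae mu, forall x, f x = g x} -> qmem g /\ qnorm g = qnorm f ;
  qmem0 : qmem (fun=> 0) ;
  qmemD : forall f g, qmem f -> qmem g -> qmem (fun x => f x + g x) ;
  qmemZ : forall a f, qmem f -> qmem (fun x => a * f x) ;
  qnorm_ge0 : forall f, qmem f -> 0 <= qnorm f ;
  qnorm_eq0 : forall f, qmem f -> qnorm f = 0 -> {ae mu, forall x, f x = 0} ;
  qnormZ : forall a f, qmem f -> qnorm (fun x => a * f x) = normc a * qnorm f ;
  qnormD : exists C : R, forall f g, qmem f -> qmem g ->
    qnorm (fun x => f x + g x) <= C * (qnorm f + qnorm g) ;
  qnorm_complete : forall u : nat -> X -> R[i], (forall n, qmem (u n)) ->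
    (forall e : R, 0 < e -> exists n0, forall m n, (n0 <= m)%N -> (n0 <= n)%N ->
       qnorm (fun x => u m x - u n x) < e) ->
    exists2 f, qmem f &
      (fun n => qnorm (fun x => u n x - f x)) @ \oo --> (0 : R) }.

Variable Y : qbfSpace.

Definition solid : Prop :=
  forall f g : X -> R[i], cmeasurable (f : borel X -> R[i]) -> qmem Y g ->
    {ae mu, forall x, normc (f x) <= normc (g x)} ->
    qmem Y f /\ qnorm Y f <= qnorm Y g.

Definition rich : Prop :=
  forall K : set X, compact K -> qmem Y (fun x => (\1_K x)%:C).

(* G is a representative of the class K(F) = \int K(., y) F(y) dmu(y), the
   integral being absolutely convergent at almost every point. *)
Definition kernel_maps (K : X -> X -> R[i]) (F G : X -> R[i]) : Prop :=
  {ae mu, forall x, cintegrable mu (fun y : borel X => K x y * F y) /\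
                    G x = cintegral mu (fun y : borel X => K x y * F y)}.

Definition kernel_bounded (K : X -> X -> R[i]) : Prop :=
  exists C : R, forall F, qmem Y F ->
    exists G, [/\ qmem Y G, kernel_maps K F G & qnorm Y G <= C * qnorm Y F].

Definition kernel_opnorm (K : X -> X -> R[i]) : R :=
  sup [set r | exists F G, [/\ qmem Y F, qnorm Y F <= 1, qmem Y G,
                               kernel_maps K F G & r = qnorm Y G]].

End qbf.

Section weights.
Context (R : realType) (X : ptopologicalType).
Variable mu : {measure set (borel X) -> \bar R}.

Definition weight (nu : X -> R) : Prop :=
  measurable_fun [set: borel X] (nu : borel X -> R) /\ forall x, 1 <= nu x.

Definition wLnorm (p : \bar R) (nu : X -> R) (F : X -> R[i]) : \bar R :=
  'N[mu]_p[(fun x : borel X => (normc (F x) * nu x)%:E)]%E.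

Definition wLp (p : \bar R) (nu : X -> R) : set (X -> R[i]) :=
  [set F | cmeasurable (F : borel X -> R[i]) /\ (wLnorm p nu F < +oo)%E].

Definition assoc_weight (nu : X -> R) (x y : X) : R :=
  Num.max (nu x / nu y) (nu y / nu x).

Definition kernel_algebra (m : X -> X -> R) : set (X -> X -> R[i]) :=
  [set K | cmeasurable (fun z : borel X * borel X => K z.1 z.2) /\
    (maxe
      (ess_sup mu (fun x => \int[mu]_y (normc (K x y) * m x y)%:E))
      (ess_sup mu (fun y => \int[mu]_x (normc (K x y) * m x y)%:E)) < +oo)%E].

End weights.

Section coorbit.
Context (R : realType) (H : completeNormedModType R[i]) (X : ptopologicalType).
Variable ip : {dot H for (@conjc R)}.
Variable mu : {measure set (borel X) -> \bar R}.
Variable phi : X -> H.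

(* Elements of the anti-dual of H_1^nu are represented by functions on H whose
   values outside of H_1^nu are irrelevant; h : H is embedded as ip h. *)
Definition voice (f : H -> R[i]) (x : X) : R[i] := f (phi x).

Definition parseval_frame : Prop :=
  (forall f : H, cmeasurable (voice (ip f) : borel X -> R[i])) /\
  (forall f : H, ((complex.Re `|f| ^+ 2)%:E =
                 \int[mu]_x (normc (voice (ip f) x) ^+ 2)%:E)%E).

Definition frame_kernel (x y : X) : R[i] := ip (phi y) (phi x).

Variable nu : X -> R.

Definition H1 : set H := [set f | wLp mu 1%E nu (voice (ip f))].

Definition H1norm (f : H) : \bar R := wLnorm mu 1%E nu (voice (ip f)).

Definition frame_condition : Prop :=
  (exists2 CB : R, 0 < CB & forall x, `|phi x| <= (CB * nu x)%:C) /\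
  kernel_algebra mu (assoc_weight nu) frame_kernel.

Definition antidual : set (H -> R[i]) :=
  [set f | (forall a u v, H1 u -> H1 v -> f (a *: u + v) = a^* * f u + f v) /\
           (exists C : R, forall u, H1 u ->
              ((normc (f u))%:E <= C%:E * H1norm u)%E)].

(* With F := totally and finite partial sums for u, this is unconditional
   convergence: the filter is that of finite index sets ordered by inclusion. *)
Definition weak_star_cvg (T : Type) (F : set_system T) (u : T -> H -> R[i])
  (f : H -> R[i]) : Prop :=
  forall z, H1 z -> (fun t => u t z) @ F --> (f z : R[i]^o).

Variable Y : qbfSpace mu.

Definition property_F : Prop :=
  (* the last clause is R(Y) `<=` L_oo^(1/nu), R(Y) carrying the norm of Y *)
  [/\ frame_condition,
      kernel_bounded Y frame_kernel &
      exists C : R, forall F G, qmem Y F -> qmem Y G ->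
        kernel_maps mu frame_kernel F G ->
        (wLnorm mu +oo (fun x => (nu x)^-1)%R G <= (C * qnorm Y G)%:E)%E].

Definition Co : set (H -> R[i]) := [set f | antidual f /\ qmem Y (voice f)].

Definition Co_norm (f : H -> R[i]) : R := qnorm Y (voice f).

End coorbit.

Section coverings.
Context (R : realType) (X : ptopologicalType) (I : choiceType).
Variable mu : {measure set (borel X) -> \bar R}.
Variable U : I -> set X.

Definition locally_finite : Prop :=
  forall x : X, exists2 V : set X, nbhs x V & finite_set [set i | U i `&` V !=set0].

Definition admissible_covering : Prop :=
  [/\ \bigcup_i U i = [set: X],
      locally_finite,
      forall i, [/\ measurable (U i : set (borel X)), precompact (U i)
                  & (U i)° !=set0] &
      exists N : nat, (forall i, [set j | U i `&` U j !=set0] #<= `I_N)%card].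

Definition star (y : X) : set X := \bigcup_(i in [set i | U i y]) U i.

(* K_U[G, F]; the supremum may be infinite, hence the extended values: it has to
   be finite almost everywhere before it is used as a complex kernel. *)
Definition sup_kernel (H : completeNormedModType R[i])
    (ip : {dot H for (@conjc R)}) (psi phi : X -> H) (x y : X) : \bar R :=
  ereal_sup [set (normc (ip (phi x) (psi z)))%:E | z in star y].

(* At each point only finitely many terms of the sum are nonzero when U is
   admissible. *)
Definition natural_fun (lam : I -> R[i]) (x : X) : R[i] :=
  (\sum_(i \in [set: I]) normc (lam i) * (fine (mu (U i)))^-1 * \1_(U i) x)%:C.

Variable Y : qbfSpace mu.

Definition natural_space : set (I -> R[i]) :=
  [set lam | qmem Y (natural_fun lam)].

Definition natural_norm (lam : I -> R[i]) : R := qnorm Y (natural_fun lam).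

Definition finite_sequences_dense : Prop :=
  forall lam, natural_space lam -> forall e : R, 0 < e ->
    exists lam', [/\ finite_set [set i | lam' i != 0], natural_space lam' &
                     natural_norm (fun i => lam i - lam' i) < e].

End coverings.

(* Main.v *)
Require Import Defs.
From HB Require Import structures.
From mathcomp Require Import all_boot all_order all_algebra finmap.
From mathcomp Require Import all_classical all_reals all_analysis.
From mathcomp Require Import measurable_realfun ess_sup_inf complex ring.
Set Implicit Arguments.
Unset Strict Implicit.
Unset Printing Implicit Defensive.
Import Order.TTheory GRing.Theory Num.Theory.
Import numFieldNormedType.Exports.
Local Open Scope classical_set_scope.
Local Open Scope ring_scope.
Local Open Scope complex_scope.

(** The series need not converge in the Hilbert space, so it is controlled by
    two estimates that are uniform in the finite index set [J].

    The first one is pointwise.  As [pt i] lies in the star of each point [y]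
    of [U i], the number [|<psi (pt i), phi x>|] is at most [K_U(x, y)] for all
    such [y], hence at most the average of [K_U(x, .)] over [U i].  Summing
    over [i] in [J], the averages add up to at most
    [\int K_U(x, y) N(y) dmu(y)], where [N] is the function whose quasi-norm is
    the norm of [lam] in the sequence space.  So
    [\sum_(i in J) |lam i V psi_i| <= |G|] almost everywhere, where [G] is the
    image of [N] under the kernel, and the quasi-norm of [G] is at most the
    operator norm times the norm of [lam] (partial_sum_voice_le_kernel,
    kernel_dominates).  By solidity each limit of the series inherits this
    bound.

    The second one concerns test vectors [z] in [H_1^nu].  Polarizing the
    Parseval identity gives [<h, z> = \int V h conj(V z)] and shows that [V h]
    is reproduced by the frame kernel for each [h] in the Hilbert space.  If
    [V h] lies in [Y], property F therefore bounds [|V h|] by a constant times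
    [nu] and the quasi-norm of [V h], so [Re <h, z>] is at most a constant times
    this quasi-norm times the [H_1^nu]-norm of [z] (property_F_Re_ip_le).
    Multiply the coefficients by phases, depending on [z], that make each term
    [lam i <psi_i, z>] nonnegative: this does not affect the pointwise bound by
    [G], hence not the bound of the quasi-norm of [V h] either, and [Re <h, z>]
    becomes [\sum_(i in J) |lam i <psi_i, z>|].  So the series converges
    absolutely against each [z], with a bound by the norm of [z]
    (synthesis_abs_le), which gives unconditional weak* convergence to a bounded
    functional.

    Both estimates together show that every weak* limit of such a series is in
    [Co] with the asserted bound (weak_star_cvg_Co).  Quasi-norm convergence is
    this bound applied to the remainder: the coefficients outside of [J] are
    dominated by those of [lam - lam'] when [lam'] is supported in [J]. *)

Local Notation normc := Normc.normc.
Local Notation Re := complex.Re.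
Local Notation Im := complex.Im.

(* Convergence along [totally] is convergence along a proper filter; type class
   resolution needs this to apply the general theory of limits. *)
#[local] Existing Instance totally_filter.

(** * Complex numbers *)

Section complex_numbers.
Context (R : realType).
Implicit Types a b w z : R[i].

Lemma normc_sqrtE z : normc z = Num.sqrt (Re z ^+ 2 + Im z ^+ 2).
Proof. by case: z. Qed.

Lemma normc_ge0 z : 0 <= normc z.
Proof. by rewrite normc_sqrtE sqrtr_ge0. Qed.

Lemma sqr_normcE z : normc z ^+ 2 = Re z ^+ 2 + Im z ^+ 2.
Proof. by rewrite normc_sqrtE sqr_sqrtr// addr_ge0 ?sqr_ge0. Qed.

Lemma normrcE z : `|z| = (normc z)%:C.
Proof. by case: z. Qed.

Lemma normc_real (r : R) : normc r%:C = `|r|.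
Proof. by rewrite normc_sqrtE /= expr0n addr0 sqrtr_sqr. Qed.

Lemma ge0_normc (r : R) : 0 <= r -> normc r%:C = r.
Proof. by move=> r0; rewrite normc_real ger0_norm. Qed.

Lemma normc_ge_abs_Re z : `|Re z| <= normc z.
Proof. by rewrite normc_sqrtE -sqrtr_sqr ler_wsqrtr// lerDl sqr_ge0. Qed.

Lemma normc_ge_abs_Im z : `|Im z| <= normc z.
Proof. by rewrite normc_sqrtE -sqrtr_sqr ler_wsqrtr// lerDr sqr_ge0. Qed.

Lemma normc_le_abs z : normc z <= `|Re z| + `|Im z|.
Proof.
rewrite -ler_sqr ?nnegrE ?normc_ge0 ?addr_ge0// sqr_normcE sqrrD.
by rewrite !real_normK ?num_real// lerD2r lerDl mulrn_wge0// mulr_ge0.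
Qed.

Lemma normc_conj z : normc (conjc z) = normc z.
Proof. by case: z => x y; rewrite !normc_sqrtE /= sqrrN. Qed.

Lemma Re_mulc a b : Re (a * b) = Re a * Re b - Im a * Im b.
Proof. by case: a b => ? ? [? ?]. Qed.

Lemma Im_mulc a b : Im (a * b) = Re a * Im b + Im a * Re b.
Proof. by case: a b => ? ? [? ?]. Qed.

Lemma Re_addc a b : Re (a + b) = Re a + Re b.
Proof. by case: a b => ? ? [? ?]. Qed.

Lemma Im_addc a b : Im (a + b) = Im a + Im b.
Proof. by case: a b => ? ? [? ?]. Qed.

Lemma Re_subc a b : Re (a - b) = Re a - Re b.
Proof. by case: a b => ? ? [? ?]. Qed.

Lemma Im_subc a b : Im (a - b) = Im a - Im b.
Proof. by case: a b => ? ? [? ?]. Qed.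

Lemma normc_polar a b :
  normc (a + b) ^+ 2 = normc a ^+ 2 + normc b ^+ 2 + 2 * Re (a * conjc b).
Proof.
by case: a b => x y [s t]; rewrite !sqr_normcE /=; ring.
Qed.

Lemma phase_exists w : exists2 a, normc a = 1 & a * w = (normc w)%:C.
Proof.
have [->|w0] := eqVneq w 0.
  by exists 1; rewrite ?Normc.normc1// mulr0 Normc.normc0.
exists ((normc w)%:C / w); last by rewrite divfK.
rewrite Normc.normcM Normc.normcV ge0_normc ?normc_ge0// divff//.
by apply: contra_neq w0 => /Normc.eq0_normc.
Qed.

Section limits.
Context (T : Type) (F : set_system T) {FF : Filter F}.

Lemma cvg_normcP (u : T -> R[i]) (l : R[i]) :
  u @ F --> (l : R[i]^o) <->
  forall e : R, 0 < e -> \forall t \near F, normc (l - u t) < e.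
Proof.
have ulP := @cvgrPdist_lt R[i] R[i]^o T F FF u l.
split => [/ulP ul e e0|ul].
  have /ul : (0 : R[i]) < e%:C by rewrite ltcR.
  by apply: filterS => t; rewrite normrcE ltcR.
apply/ulP => -[e e'] /=; rewrite ltcE /= => /andP[/eqP -> e0].
by have := ul _ e0; apply: filterS => t /=; rewrite complexr0 normrcE ltcR.
Qed.

Lemma cvg_complexP (u : T -> R[i]) (l : R[i]) :
  u @ F --> (l : R[i]^o) <->
  (fun t => Re (u t)) @ F --> Re l /\ (fun t => Im (u t)) @ F --> Im l.
Proof.
split => [/cvg_normcP ul|[/cvgrPdist_lt Reul /cvgrPdist_lt Imul]].
- split; apply/(@cvgrPdist_lt R R^o) => e e0; move: (ul _ e0);
    apply: filterS => t; apply: le_lt_trans.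
    by rewrite -Re_subc normc_ge_abs_Re.
  by rewrite -Im_subc normc_ge_abs_Im.
- apply/cvg_normcP => e e0.
  have e20 : 0 < e / 2 by rewrite divr_gt0.
  move: (Reul _ e20) (Imul _ e20); apply: filterS2 => t Ret Imt.
  rewrite (le_lt_trans (normc_le_abs _))//.
  by rewrite (splitr e) Re_subc Im_subc ltrD.
Qed.

End limits.
End complex_numbers.

(** * Sums along the finite index sets *)

Section unconditional_sums.
Context (R : realType) (I : choiceType).

Lemma partial_sumE (V : zmodType) (u : I -> V) (J : {fset I}) :
  partial_sum u J = \sum_(i <- J) u i.
Proof. by rewrite /partial_sum (big_seq_fsetE _ _ predT). Qed.

Lemma near_totallyP (P : {fset I} -> Prop) :
  (\forall J \near totally, P J) <->
  exists J0 : {fset I}, forall J : {fset I}, (J0 `<=` J)%fset -> P J.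
Proof.
by split => [[J0 _ J0P]|[J0 J0P]]; exists J0.
Qed.

Lemma partial_sum_le (u : I -> R) (J K : {fset I}) :
  (forall i, 0 <= u i) -> (J `<=` K)%fset -> partial_sum u J <= partial_sum u K.
Proof.
move=> u0 JK; rewrite !partial_sumE [leRHS](big_fsetID _ (mem J))/=.
have -> : [fset x in K | x \in J]%fset = J.
  apply/fsetP => i; rewrite !inE/= andbC.
  by have [/(fsubsetP JK) ->|] := boolP (i \in J).
by rewrite lerDl sumr_ge0.
Qed.

Lemma partial_sum_ge0_cvg (u : I -> R) (C : R) :
  (forall i, 0 <= u i) -> (forall J, partial_sum u J <= C) ->
  exists l : R, partial_sum u @ totally --> l.
Proof.
move=> u0 uC; pose E := range (partial_sum u).
have supE : has_sup E.
  by split; [exists (partial_sum u fset0), fset0|exists C => _ [J _ <-]].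
exists (sup E); apply/(@cvgrPdist_lt R R^o) => e e0.
have [_ [J0 _ <-] J0e] := sup_adherent e0 supE.
apply/near_totallyP; exists J0 => J J0J.
have uJ : partial_sum u J <= sup E by apply: sup_upper_bound => //; exists J.
rewrite ger0_norm ?subr_ge0// ltrBlDr addrC -ltrBlDr (lt_le_trans J0e)//.
exact: partial_sum_le.
Qed.

(** [u] is the difference of [`|u| + u] and [`|u|], whose partial sums are
    bounded and monotone. *)
Lemma partial_sum_real_cvg (u : I -> R) (C : R) :
  (forall J, partial_sum (fun i => `|u i|) J <= C) ->
  exists l : R, partial_sum u @ totally --> l.
Proof.
move=> uC.
have [//|//|l ul] := @partial_sum_ge0_cvg (fun i => `|u i|) C.
have [i|J|m um] := @partial_sum_ge0_cvg (fun i => `|u i| + u i) (2 * C).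
- by rewrite -lerBlDr sub0r -normrN ler_norm.
- rewrite (@le_trans _ _ (2 * partial_sum (fun i => `|u i|) J))//; last first.
    by rewrite ler_pM2l.
  rewrite !partial_sumE mulr_sumr ler_sum// => i _.
  by rewrite mulr_natl mulr2n lerD2l ler_norm.
exists (m - l).
have -> : partial_sum u = fun J => partial_sum (fun i => `|u i| + u i) J -
    partial_sum (fun i => `|u i|) J.
  apply/funext => J; rewrite !partial_sumE -sumrB; apply: eq_bigr => i _.
  by rewrite addrAC subrr add0r.
exact: (@cvgB R R^o).
Qed.

Lemma Re_partial_sum (u : I -> R[i]) J :
  Re (partial_sum u J) = partial_sum (fun i => Re (u i)) J.
Proof. by rewrite !partial_sumE (big_morph _ (@Re_addc R) (erefl _)). Qed.

Lemma Im_partial_sum (u : I -> R[i]) J :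
  Im (partial_sum u J) = partial_sum (fun i => Im (u i)) J.
Proof. by rewrite !partial_sumE (big_morph _ (@Im_addc R) (erefl _)). Qed.

Lemma normc_partial_sum (u : I -> R[i]) J :
  normc (partial_sum u J) <= partial_sum (fun i => normc (u i)) J.
Proof.
rewrite !partial_sumE; elim/big_rec2: _ => [|i y1 y2 _ le_y].
  by rewrite Normc.normc0.
by rewrite (le_trans (le_normcD _ _))// lerD2l.
Qed.

Lemma partial_sum_complex_cvg (u : I -> R[i]) (C : R) :
  (forall J, partial_sum (fun i => normc (u i)) J <= C) ->
  exists l : R[i], partial_sum u @ totally --> (l : R[i]^o).
Proof.
move=> uC.
have [J|x ux] := @partial_sum_real_cvg (fun i => Re (u i)) C.
  rewrite (le_trans _ (uC J))// !partial_sumE ler_sum// => i _.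
  exact: normc_ge_abs_Re.
have [J|y uy] := @partial_sum_real_cvg (fun i => Im (u i)) C.
  rewrite (le_trans _ (uC J))// !partial_sumE ler_sum// => i _.
  exact: normc_ge_abs_Im.
exists (x +i* y); apply/cvg_complexP; split.
- by rewrite (_ : (fun _ => _) = partial_sum (fun i => Re (u i)))//;
    apply/funext => J; rewrite Re_partial_sum.
- by rewrite (_ : (fun _ => _) = partial_sum (fun i => Im (u i)))//;
    apply/funext => J; rewrite Im_partial_sum.
Qed.

Lemma normc_lim_le (T : Type) (F : set_system T) {FF : ProperFilter F}
    (u : T -> R[i]) (l : R[i]) (C : R) :
  u @ F --> (l : R[i]^o) -> (\forall t \near F, normc (u t) <= C) ->
  normc l <= C.
Proof.
move=> /cvg_normcP ul uC; apply/ler_addgt0Pl => e e0.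
have [t [lt_e le_C]] := filter_ex (filterI (ul _ e0) uC).
by rewrite -(subrK (u t) l) (le_trans (le_normcD _ _))// lerD// ltW.
Qed.

Lemma totally_exhaustion : countable [set: I] ->
  exists J : nat -> {fset I}, J @ \oo --> totally.
Proof.
move=> /countable_injP[g ginj].
have fin n : finite_set [set i | (g i < n)%N].
  apply: (finite_preimage (f := g) (B := `I_n)) => //.
  by move=> i j _ _; apply: ginj; rewrite inE.
exists (fun n => fset_set [set i | (g i < n)%N]).
move=> P /near_totallyP[J0 J0P].
exists (\max_(i <- J0) (g i).+1)%N => // n /= le_n; apply: J0P.
apply/fsubsetP => i iJ0; rewrite in_fset_set// inE/=.
apply: leq_trans le_n.
exact: (@leq_bigmax_seq _ _ predT (fun i => (g i).+1)).
Qed.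

(** Measurability only survives sequential limits: countability of the index
    set replaces the net of finite index sets by an increasing sequence. *)
Lemma measurable_fun_totally_cvg d (T : measurableType d)
    (v : {fset I} -> T -> R) (g : T -> R) :
  countable [set: I] -> (forall J, measurable_fun [set: T] (v J)) ->
  (forall x, v^~ x @ totally --> g x) -> measurable_fun [set: T] g.
Proof.
move=> /totally_exhaustion[J Jtot] mv vg.
apply: (@measurable_fun_cvg _ _ _ _ (fun n => v (J n))) => [//|x _].
exact: (cvg_comp J (v^~ x) Jtot (vg x)).
Qed.

End unconditional_sums.

(** * Inner products and the Parseval identity *)

Section measurability.
Context d (T : measurableType d) (R : realType).

Lemma measurable_normc (f : T -> R[i]) :
  cmeasurable f -> measurable_fun [set: T] (fun x => normc (f x)).
Proof.
move=> [mRe mIm]; under eq_fun do rewrite normc_sqrtE.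
apply: (@measurableT_comp _ _ _ _ _ _ (@Num.sqrt R)).
  by apply: continuous_measurable_fun; exact: sqrt_continuous.
by apply: measurable_funD; exact: measurable_funX.
Qed.

Lemma cmeasurable_real (f : T -> R) :
  measurable_fun [set: T] f -> cmeasurable (fun x => (f x)%:C).
Proof. by move=> mf; split => //=; exact: measurable_cst. Qed.

End measurability.

Section inner_product.
Context (R : realType) (H : completeNormedModType R[i]).
Variable ip : {dot H for (@conjc R)}.

Lemma ipDl u v w : ip (u + v) w = ip u w + ip v w.
Proof. exact: linearDl. Qed.

Lemma ipBl u v w : ip (u - v) w = ip u w - ip v w.
Proof. exact: linearBl. Qed.

Lemma ipZl a u w : ip (a *: u) w = a * ip u w.
Proof. exact: linearZl_LR. Qed.

Lemma ip_conj u v : ip u v = conjc (ip v u).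
Proof. by rewrite hermC expr0 mul1r. Qed.

Lemma ipDr u v w : ip u (v + w) = ip u v + ip u w.
Proof. by rewrite ip_conj ipDl rmorphD (ip_conj u v) (ip_conj u w). Qed.

Lemma ipZr a u w : ip u (a *: w) = conjc a * ip u w.
Proof. by rewrite ip_conj ipZl rmorphM (ip_conj u w). Qed.

Lemma ip_suml (I : Type) (s : seq I) (u : I -> H) v :
  ip (\sum_(i <- s) u i) v = \sum_(i <- s) ip (u i) v.
Proof.
apply: (big_morph (ip ^~ v)); first by move=> ? ?; rewrite ipDl.
by rewrite -[X in ip X](scale0r 0) ipZl mul0r.
Qed.

Hypothesis ip_norm : forall f : H, `|f| ^+ 2 = ip f f.

(* The norm of [H] has values in [R[i]], where nonnegative elements are real. *)
Lemma sqr_Re_norm (f : H) : Re `|f| ^+ 2 = Re (ip f f).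
Proof.
by rewrite -ip_norm expr2 Re_mulc (ger0_Im (normr_ge0 f)) mulr0 subr0.
Qed.

Lemma Re_ip_polar (f g : H) :
  Re (ip (f + g) (f + g)) = Re (ip f f) + Re (ip g g) + 2 * Re (ip f g).
Proof.
rewrite ipDl !ipDr !Re_addc (ip_conj g f).
by case: (ip f g) => x y /=; ring.
Qed.

End inner_product.

Section frame.
Context (R : realType) (H : completeNormedModType R[i]).
Variable ip : {dot H for (@conjc R)}.
Hypothesis ip_norm : forall f : H, `|f| ^+ 2 = ip f f.
Context (X : ptopologicalType) (mu : {measure set (borel X) -> \bar R}).
Variable phi : X -> H.
Hypothesis phi_frame : parseval_frame ip mu phi.

Local Notation V h := (voice phi (ip h)).

Lemma voice_cmeasurable h : cmeasurable (V h : borel X -> R[i]).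
Proof. exact: phi_frame.1. Qed.

Lemma measurable_normc_voice h :
  measurable_fun [set: borel X] (fun x => normc (V h x)).
Proof. by apply: measurable_normc; exact: voice_cmeasurable. Qed.

Lemma integral_sqr_voice h :
  (\int[mu]_x (normc (V h x) ^+ 2)%:E)%E = (Re (ip h h))%:E.
Proof. by rewrite -(sqr_Re_norm ip_norm) phi_frame.2. Qed.

Lemma integrable_sqr_voice h :
  mu.-integrable [set: borel X] (EFin \o (fun x => normc (V h x) ^+ 2)).
Proof.
apply/integrableP; split.
  apply/measurable_EFinP; apply: measurable_funX.
  exact: measurable_normc_voice.
under eq_integral do rewrite gee0_abs ?lee_fin ?sqr_ge0//.
by rewrite integral_sqr_voice ltry.
Qed.

(** Polarization: real parts suffice, since the imaginary part of a product is
    the real part of [-i] times it, and [-i] can be absorbed in [f]. *)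
Lemma Re_parseval f g :
  mu.-integrable [set: borel X]
    (EFin \o (fun x => Re (V f x * conjc (V g x)))) /\
  \int[mu]_x Re (V f x * conjc (V g x)) = Re (ip f g).
Proof.
have polar : (fun x => Re (V f x * conjc (V g x))) = fun x =>
    2^-1 * ((normc (V (f + g) x) ^+ 2 - normc (V f x) ^+ 2) -
            normc (V g x) ^+ 2).
  by apply/funext => x; rewrite /voice ipDl normc_polar; field.
have iB : mu.-integrable [set: borel X] (EFin \o (fun x =>
    normc (V (f + g) x) ^+ 2 - normc (V f x) ^+ 2)).
  by have := integrableB measurableT (integrable_sqr_voice (f + g))
    (integrable_sqr_voice f).
have iBB : mu.-integrable [set: borel X] (EFin \o (fun x =>
    (normc (V (f + g) x) ^+ 2 - normc (V f x) ^+ 2) - normc (V g x) ^+ 2)).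
  by have := integrableB measurableT iB (integrable_sqr_voice g).
have RintE h : \int[mu]_x (normc (V h x) ^+ 2) = Re (ip h h).
  by rewrite /Rintegral integral_sqr_voice.
rewrite polar; split; first by have := integrableZl measurableT 2^-1 iBB.
rewrite RintegralZl// RintegralB//; last exact: integrable_sqr_voice.
rewrite RintegralB//; [|exact: integrable_sqr_voice..].
by rewrite !RintE Re_ip_polar; field.
Qed.

(** The frame kernel reproduces every analysis transform: the action of the
    kernel on [V h] at [x] is the Parseval identity for [h] and [phi x]. *)
Lemma frame_kernel_reproducing h :
  kernel_maps mu (frame_kernel ip phi) (V h) (V h).
Proof.
apply: aeW => x.
have ReE : (fun y => Re (frame_kernel ip phi x y * V h y)) =
    fun y => Re (V h y * conjc (V (phi x) y)).
  by apply/funext => y; rewrite /frame_kernel /voice mulrC (ip_conj ip (phi y)).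
have ImE : (fun y => Im (frame_kernel ip phi x y * V h y)) =
    fun y => Re (V ((0 -i* 1) *: h) y * conjc (V (phi x) y)).
  apply/funext => y; rewrite /frame_kernel /voice mulrC (ip_conj ip (phi y)).
  by rewrite ipZl -mulrA Re_mulc/= mul0r add0r mulN1r opprK.
have [iRe intRe] := Re_parseval h (phi x).
have [iIm intIm] := Re_parseval ((0 -i* 1) *: h) (phi x).
split; first by split; [move: iRe; rewrite -ReE|move: iIm; rewrite -ImE].
rewrite /cintegral.
rewrite [X in _ = X +i* _](_ : _ = Re (ip h (phi x))); last first.
  by rewrite -intRe -ReE.
rewrite [X in _ = _ +i* X](_ : _ = Im (ip h (phi x))).
  by rewrite /voice; case: (ip h (phi x)).
by rewrite [LHS](_ : _ = Re (ip ((0 -i* 1) *: h) (phi x)));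
  [rewrite ipZl Re_mulc/= mul0r add0r mulN1r opprK|rewrite -intIm -ImE].
Qed.

Variable nu : X -> R.
Hypothesis nu_weight : weight nu.

Let nu_gt0 x : 0 < nu x.
Proof. by rewrite (lt_le_trans ltr01)// nu_weight.2. Qed.

Lemma H1normE z : H1norm ip mu phi nu z =
  (\int[mu]_x (normc (V z x) * nu x)%:E)%E.
Proof.
rewrite /H1norm /wLnorm Lnorm1; apply: eq_integral => x _.
by rewrite gee0_abs// lee_fin mulr_ge0 ?normc_ge0 ?ltW.
Qed.

Lemma H1norm_ge0 z : (0 <= H1norm ip mu phi nu z)%E.
Proof. exact: Lnorm_ge0. Qed.

Lemma ae_measure0 (P : X -> Prop) : mu [set: X] = 0%E -> {ae mu, forall x, P x}.
Proof. by move=> mu0; exists [set: X]; split. Qed.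

Lemma wLnorm_oo_ae (F : X -> R[i]) (C : R) :
  (wLnorm mu +oo (fun x => (nu x)^-1)%R F <= C%:E)%E ->
  {ae mu, forall x, normc (F x) <= C * nu x}.
Proof.
rewrite /wLnorm unlock; case: ifPn => [_ /ess_supP|]; last first.
  rewrite -leNgt measure_le0 => /eqP mu0 _; exact: ae_measure0.
apply: filterS => x /=; rewrite lee_fin.
by rewrite ger0_norm ?divr_ge0 ?normc_ge0 ?(ltW (nu_gt0 x))// ler_pdivrMr.
Qed.

(** The duality between [L_oo^(1/nu)] and [L_1^nu], applied to the two analysis
    transforms. *)
Lemma Re_ip_le_H1norm h z (C : R) : 0 <= C ->
  {ae mu, forall x, normc (V h x) <= C * nu x} ->
  ((Re (ip h z))%:E <= C%:E * H1norm ip mu phi nu z)%E.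
Proof.
move=> C0 hC; have [iRe <-] := Re_parseval h z.
rewrite fineK; last exact: integrable_fin_num.
rewrite (le_trans (lee_abs _))// (le_trans (le_abse_integral _ _ _))//.
  by apply: measurable_int iRe.
have mVnu : measurable_fun [set: borel X] (fun x => (normc (V z x) * nu x)%:E).
  apply/measurable_EFinP/measurable_funM; first exact: measurable_normc_voice.
  exact: nu_weight.1.
have Vnu0 x : 0 <= normc (V z x) * nu x by rewrite mulr_ge0 ?normc_ge0 ?ltW.
rewrite H1normE -ge0_integralZl//; last by move=> x _; rewrite lee_fin.
apply: (ae_ge0_le_integral measurableT) => //.
- by apply: measurableT_comp => //; apply: measurable_int iRe.
- by move=> x _; rewrite mule_ge0// lee_fin.
- exact: measurable_funeM.
apply: (@filterS _ _ (ae_filter_ringOfSetsType mu) _ _ _ hC) => x {}hC _ /=.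
rewrite lee_fin (le_trans (normc_ge_abs_Re _))// Normc.normcM normc_conj.
by rewrite mulrA mulrAC ler_wpM2r ?normc_ge0.
Qed.

Variable Y : qbfSpace mu.
Hypothesis phi_F : property_F ip phi nu Y.

(** Property F bounds only functions in the image of the frame kernel; it
    applies to [V h] because [V h] is its own image. *)
Lemma property_F_Re_ip_le : exists2 C : R, 0 <= C & forall h z,
  qmem Y (V h) ->
  ((Re (ip h z))%:E <= (C * qnorm Y (V h))%:E * H1norm ip mu phi nu z)%E.
Proof.
have [_ _ [C RC]] := phi_F; exists `|C| => // h z hY.
have q0 : 0 <= qnorm Y (V h) by exact: qnorm_ge0.
apply: Re_ip_le_H1norm; first by rewrite mulr_ge0.
apply: wLnorm_oo_ae; rewrite (le_trans (RC _ _ hY hY _))//.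
  exact: frame_kernel_reproducing.
by rewrite lee_fin ler_wpM2r// ler_norm.
Qed.

End frame.

(** * Operator norms of kernels *)

Section quasi_banach_functions.
Context (R : realType) (X : ptopologicalType).
Variables (mu : {measure set (borel X) -> \bar R}) (Y : qbfSpace mu).
Variable K : X -> X -> R[i].

Lemma kernel_maps_ae_unique F G G' : kernel_maps mu K F G ->
  kernel_maps mu K F G' -> {ae mu, forall x, G x = G' x}.
Proof.
apply: (@filterS2 _ _ (ae_filter_ringOfSetsType mu)) => x [_ ->] [_ ->//].
Qed.

Lemma kernel_mapsZ (r : R) F G : kernel_maps mu K F G ->
  kernel_maps mu K (fun x => r%:C * F x) (fun x => r%:C * G x).
Proof.
apply: (@filterS _ _ (ae_filter_ringOfSetsType mu)) => x [[iRe iIm] ->].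
have KrE y : K x y * (r%:C * F y) = r%:C * (K x y * F y) by rewrite mulrCA.
have ReE y : Re (K x y * (r%:C * F y)) = r * Re (K x y * F y).
  by rewrite KrE Re_mulc /= mul0r subr0.
have ImE y : Im (K x y * (r%:C * F y)) = r * Im (K x y * F y).
  by rewrite KrE Im_mulc /= mul0r addr0.
split; first split.
- rewrite (_ : (fun y => _) =
      fun y : borel X => (r%:E * (Re (K x y * F y))%:E)%E).
    exact: integrableZl.
  by apply/funext => y; rewrite -EFinM -ReE.
- rewrite (_ : (fun y => _) =
      fun y : borel X => (r%:E * (Im (K x y * F y))%:E)%E).
    exact: integrableZl.
  by apply/funext => y; rewrite -EFinM -ImE.
have cZ (a b : R) : r%:C * (a +i* b) = (r * a) +i* (r * b) by simpc.
rewrite /cintegral cZ -!RintegralZl//.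
by congr (_ +i* _); apply: eq_Rintegral => y _; rewrite -?ReE -?ImE.
Qed.

(** In the absence of a supremum, [sup] is [0] by convention. *)
Lemma kernel_opnorm_ge0 : 0 <= kernel_opnorm Y K.
Proof.
rewrite /kernel_opnorm; set E := [set r | _].
have [supE|/sup_out ->//] := pselect (has_sup E).
have [[r Er] _] := supE; apply: le_trans (sup_upper_bound supE Er).
by have [F [G [_ _ YG _ ->]]] := Er; exact: qnorm_ge0.
Qed.

Hypothesis K_bounded : kernel_bounded Y K.

(** Boundedness provides one image of [F] with the estimate; the other images
    are almost everywhere equal to it. *)
Lemma qnorm_kernel_image_le : exists C : R, forall F G,
  qmem Y F -> qmem Y G -> kernel_maps mu K F G -> qnorm Y G <= C * qnorm Y F.
Proof.
have [C KC] := K_bounded; exists C => F G YF YG FG.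
have [G' [YG' FG' le_G']] := KC _ YF.
have GG' := kernel_maps_ae_unique FG' FG.
by have [_ ->] := qmem_ae YG' (qmem_measurable YG) GG'.
Qed.

(** By homogeneity it suffices to normalise [F]; when [F] has quasi-norm zero,
    some bound on the operator already forces [G] to have quasi-norm zero. *)
Lemma qnorm_le_kernel_opnorm F G : qmem Y F -> qmem Y G ->
  kernel_maps mu K F G -> qnorm Y G <= kernel_opnorm Y K * qnorm Y F.
Proof.
move=> YF YG FG; have [C KC] := qnorm_kernel_image_le.
have [q0|qN0] := eqVneq (qnorm Y F) 0.
  by rewrite q0 mulr0 (le_trans (KC _ _ YF YG FG))// q0 mulr0.
have q_gt0 : 0 < qnorm Y F by rewrite lt_def qN0 qnorm_ge0.
pose r := (qnorm Y F)^-1; have r0 : 0 < r by rewrite invr_gt0.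
have nr : normc r%:C = r by rewrite ge0_normc// ltW.
rewrite -ler_pdivrMr// mulrC -/r -nr -qnormZ// /kernel_opnorm.
set E := [set s | _]; have Er : E (qnorm Y (fun x => r%:C * G x)).
  exists (fun x => r%:C * F x), (fun x => r%:C * G x).
  split=> //; [exact: qmemZ| |exact: qmemZ|exact: kernel_mapsZ].
  by rewrite qnormZ// nr mulVf.
apply: sup_upper_bound => //; split; first by eexists; exact: Er.
exists `|C| => _ [F1 [G1 [YF1 F1le1 YG1 FG1 ->]]].
rewrite (le_trans (KC _ _ YF1 YG1 FG1))//.
rewrite (le_trans (ler_wpM2r _ (ler_norm C)))//; first exact: qnorm_ge0.
by rewrite -[leRHS]mulr1 ler_wpM2l.
Qed.

End quasi_banach_functions.

(** * Admissible coverings *)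

Section covering.
Context (R : realType) (X : ptopologicalType).
Variable mu : {measure set (borel X) -> \bar R}.
Context (I : choiceType) (U : I -> set X).

Lemma finite_cells_through x : locally_finite U -> finite_set [set i | U i x].
Proof.
move=> /(_ x)[V Vx]; apply: sub_finite_set => i Uix.
by exists x; split=> //; exact: nbhs_singleton.
Qed.

(** Local finiteness is a statement near each point about the finite index sets
    containing every cell met there, so compactness makes it uniform. *)
Lemma finite_cells_meeting_compact (K : set X) :
  locally_finite U -> compact K ->
  exists J : {fset I}, forall x i, K x -> U i x -> i \in J.
Proof.
move=> Ulf /compact_near_coveringP Kc.
have /near_totallyP[J JP] : \forall J \near (@totally I),
    K `<=` [set x | forall i, U i x -> i \in J].
  apply: (Kc _ _ (fun (J : {fset I}) x => forall i, U i x -> i \in J)) => x Kx.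
  have [V Vx finV] := Ulf x.
  exists (V, [set J : {fset I} |
    (fset_set [set i | U i `&` V !=set0] `<=` J)%fset]).
    by split=> //=; apply/near_totallyP; eexists => J; exact.
  move=> [y J] /= [Vy /fsubsetP VJ] i Uiy; apply: VJ.
  by rewrite in_fset_set// inE; exists y.
by exists J => x i Kx; apply: JP Kx _.
Qed.

Lemma locally_finite_countable : sigma_compact X -> locally_finite U ->
  (forall i, U i !=set0) -> countable [set: I].
Proof.
move=> [K [Kc Kcover]] Ulf U0.
have /choice[J JP] n := finite_cells_meeting_compact Ulf (Kc n).
apply: (@sub_countable _ _ _ (\bigcup_n [set` J n])).
  apply: subset_card_le => i _; have [x Uix] := U0 i.
  have [n _ Knx] : (\bigcup_n K n) x by rewrite Kcover.
  by exists n => //; exact: JP Uix.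
apply: bigcup_countable => // n _; exact: finite_set_countable.
Qed.

Hypothesis mu_radon : radon_measure mu.
Hypothesis mu_supp : supp mu = [set: X].
Hypothesis U_admissible : admissible_covering U.

Lemma open_borel (O : set X) : open O -> measurable (O : set (borel X)).
Proof. by move=> oO; apply: sub_sigma_algebra. Qed.

Lemma closed_borel (C : set X) : closed C -> measurable (C : set (borel X)).
Proof.
move=> cC; rewrite -[C]setCK; apply: measurableC; apply: open_borel.
exact: closed_openC.
Qed.

Lemma cell_measurable i : measurable (U i : set (borel X)).
Proof. by have [_ _ /(_ i)[]] := U_admissible. Qed.

Lemma cell_measure_fin i : mu (U i) \is a fin_num.
Proof.
have [_ _ /(_ i)[mU + _] _] := U_admissible; rewrite precompactE => cU.
have [/(_ _ cU) lty _ _] := mu_radon.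
rewrite ge0_fin_numE// (le_lt_trans _ lty)// le_measure ?inE//.
  by apply: closed_borel; exact: closed_closure.
exact: subset_closure.
Qed.

(** A cell has interior points, and these belong to the support of [mu]. *)
Lemma cell_measure_gt0 i : 0 < fine (mu (U i)).
Proof.
have [_ _ /(_ i)[mU _ [x Ux]] _] := U_admissible.
have : supp mu x by rewrite mu_supp.
move=> /(_ _ (open_interior (U i)) Ux) lt0.
rewrite fine_gt0// (lt_le_trans lt0)/=; last first.
  rewrite le_measure ?inE//; last exact: interior_subset.
  by apply: open_borel; exact: open_interior.
by rewrite ltey_eq cell_measure_fin.
Qed.

Lemma admissible_countable : sigma_compact X -> countable [set: I].
Proof.
have [_ Ulf Ucell _] := U_admissible => Xs.
apply: locally_finite_countable => // i.
by have [_ _ [x /interior_subset Ux]] := Ucell i; exists x.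
Qed.

End covering.

(** * The sequence space and the kernel estimate *)

Section natural_space.
Context (R : realType) (X : ptopologicalType).
Variable mu : {measure set (borel X) -> \bar R}.
Context (I : choiceType) (U : I -> set X).
Hypothesis X_sigma_compact : sigma_compact X.
Hypothesis mu_radon : radon_measure mu.
Hypothesis mu_supp : supp mu = [set: X].
Hypothesis U_admissible : admissible_covering U.

Definition natural_term (lam : I -> R[i]) (x : X) (i : I) : R :=
  normc (lam i) * (fine (mu (U i)))^-1 * \1_(U i) x.

Lemma natural_term_ge0 lam x i : 0 <= natural_term lam x i.
Proof.
by rewrite !mulr_ge0 ?normc_ge0// invr_ge0 fine_ge0.
Qed.

Lemma Re_natural_funE lam x :
  Re (natural_fun mu U lam x) = \sum_(i \in [set: I]) natural_term lam x i.
Proof. by []. Qed.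

(** A point lies in finitely many cells, so the sum over all cells is the sum
    over each sufficiently large finite index set. *)
Lemma natural_fun_eventually lam x : exists J0 : {fset I}, forall J,
  (J0 `<=` J)%fset ->
  partial_sum (natural_term lam x) J = Re (natural_fun mu U lam x).
Proof.
have [_ Ulf _ _] := U_admissible; have finU := finite_cells_through x Ulf.
have notin i : ~ U i x -> natural_term lam x i = 0.
  by move=> NUix; rewrite /natural_term indicE memNset// mulr0.
exists (fset_set [set i | U i x]) => J J0J.
rewrite Re_natural_funE -(fsbig_widen [set i | U i x])//; last first.
  by move=> i [_ NUix]; exact: notin.
rewrite fsbig_finite// partial_sumE -(big_fset_incl _ J0J)// => i _.
by rewrite in_fset_set// notin_setE => /notin.
Qed.

Lemma natural_fun_cvg lam x :
  partial_sum (natural_term lam x) @ totally --> Re (natural_fun mu U lam x).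
Proof.
have [J0 J0P] := natural_fun_eventually lam x.
apply/(@cvgrPdist_lt R R^o) => e e0.
by apply/near_totallyP; exists J0 => J /J0P ->; rewrite subrr normr0.
Qed.

Lemma partial_sum_le_natural_fun lam x J :
  partial_sum (natural_term lam x) J <= Re (natural_fun mu U lam x).
Proof.
have [J0 J0P] := natural_fun_eventually lam x.
rewrite -(J0P (J0 `|` J)%fset) ?fsubsetUl//; apply: partial_sum_le.
  by move=> i; exact: natural_term_ge0.
exact: fsubsetUr.
Qed.

Lemma Re_natural_fun_ge0 lam x : 0 <= Re (natural_fun mu U lam x).
Proof.
rewrite (le_trans _ (partial_sum_le_natural_fun lam x fset0))//.
by rewrite partial_sumE big_seq_fset0.
Qed.

Lemma natural_fun_cmeasurable lam :
  cmeasurable (natural_fun mu U lam : borel X -> R[i]).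
Proof.
apply: (@cmeasurable_real _ (borel X)).
apply: (@measurable_fun_totally_cvg R I _ (borel X)
  (fun J x => partial_sum (natural_term lam x) J)).
- exact: (admissible_countable U_admissible).
- move=> J; under eq_fun do rewrite partial_sumE.
  apply: measurable_sum => i.
  apply: measurable_funM; first exact: measurable_cst.
  by apply: measurable_indic; exact: cell_measurable.
- exact: natural_fun_cvg.
Qed.

Lemma natural_fun_mono lam lam' x :
  (forall i, normc (lam i) <= normc (lam' i)) ->
  Re (natural_fun mu U lam x) <= Re (natural_fun mu U lam' x).
Proof.
move=> le_lam; have [J0 J0P] := natural_fun_eventually lam x.
rewrite -(J0P J0)// (le_trans _ (partial_sum_le_natural_fun lam' x J0))//.
rewrite !partial_sumE ler_sum// => i _.
by rewrite !ler_wpM2r// invr_ge0 fine_ge0.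
Qed.

Lemma natural_fun_sub_le lam lam' x :
  Re (natural_fun mu U (fun i => lam i - lam' i) x) <=
  Re (natural_fun mu U lam x) + Re (natural_fun mu U lam' x).
Proof.
have [J0 J0P] := natural_fun_eventually (fun i => lam i - lam' i) x.
rewrite -(J0P J0)//.
apply: le_trans (lerD (partial_sum_le_natural_fun lam x J0)
  (partial_sum_le_natural_fun lam' x J0)).
rewrite !partial_sumE -big_split ler_sum//= => i _.
rewrite /natural_term -!mulrDl; apply: ler_wpM2r => //; apply: ler_wpM2r.
  by rewrite invr_ge0 fine_ge0.
by rewrite (le_trans (le_normcD _ _))// normcN.
Qed.

Variable Y : qbfSpace mu.
Hypothesis Y_solid : solid Y.

Lemma normc_natural_fun lam x :
  normc (natural_fun mu U lam x) = Re (natural_fun mu U lam x).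
Proof. by rewrite ge0_normc//; exact: Re_natural_fun_ge0. Qed.

Lemma natural_space_solid lam lam' : natural_space U Y lam' ->
  (forall i, normc (lam i) <= normc (lam' i)) ->
  natural_space U Y lam /\ natural_norm U Y lam <= natural_norm U Y lam'.
Proof.
move=> Ylam' le_lam; apply: Y_solid Ylam' _.
  exact: natural_fun_cmeasurable.
by apply: aeW => x; rewrite !normc_natural_fun natural_fun_mono.
Qed.

Lemma natural_spaceB lam lam' : natural_space U Y lam ->
  natural_space U Y lam' -> natural_space U Y (fun i => lam i - lam' i).
Proof.
move=> Ylam Ylam'; have YD := qmemD Ylam Ylam'.
apply: (Y_solid _ YD _).1; first exact: natural_fun_cmeasurable.
apply: aeW => x; rewrite normc_natural_fun.
rewrite (le_trans (natural_fun_sub_le _ _ x))//.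
by rewrite -Re_addc (le_trans (ler_norm _))// normc_ge_abs_Re.
Qed.

Context (H : completeNormedModType R[i]) (ip : {dot H for (@conjc R)}).
Variables (psi phi : X -> H) (pt : I -> X).
Hypothesis pt_U : forall i, U i (pt i).

Lemma sup_kernel_ge x y i : U i y ->
  ((normc (ip (phi x) (psi (pt i))))%:E <= sup_kernel U ip psi phi x y)%E.
Proof.
by move=> Uiy; apply: ereal_sup_ubound; exists (pt i) => //; exists i.
Qed.

Lemma sup_kernel_ge0 x y : (0 <= sup_kernel U ip psi phi x y)%E.
Proof.
have [cov _ _ _] := U_admissible.
have [i _ Uiy] : (\bigcup_i U i) y by rewrite cov.
by apply: le_trans (sup_kernel_ge x Uiy); rewrite lee_fin normc_ge0.
Qed.

Hypothesis KU_finite : {ae mu, forall x, {ae mu, forall y,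
  (sup_kernel U ip psi phi x y < +oo)%E}}.

(** Averaging over the cell of [i] the inequality between the transform of
    [psi (pt i)] and the kernel gives an estimate that is uniform in the finite
    index set, because the averages add up to the action of the kernel. *)
Lemma partial_sum_voice_le_kernel lam G :
  kernel_maps mu (fun x y => (fine (sup_kernel U ip psi phi x y))%:C)
    (natural_fun mu U lam) G ->
  {ae mu, forall x, forall J,
    partial_sum (fun i => normc (lam i * voice phi (ip (psi (pt i))) x)) J <=
    normc (G x)}.
Proof.
move: KU_finite; apply: (@filterS2 _ _ (ae_filter_ringOfSetsType mu)).
move=> x KUx [[iRe _] Gx] J.
(* [c i] times the indicator of [U i] has integral the term of index [i]. *)
pose c i := normc (lam i * voice phi (ip (psi (pt i))) x) / fine (mu (U i)).
have c0 i : 0 <= c i by rewrite divr_ge0 ?normc_ge0// ltW// cell_measure_gt0.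
have mU i : measurable (U i : set (borel X)) by exact: cell_measurable.
pose k y := (fine (sup_kernel U ip psi phi x y))%:C * natural_fun mu U lam y.
have k_ge0 y : 0 <= Re (k y).
  rewrite Re_mulc /= mul0r subr0 mulr_ge0 ?fine_ge0 ?sup_kernel_ge0//.
  exact: Re_natural_fun_ge0.
have ReG : Re (G x) = \int[mu]_y Re (k y) by rewrite Gx.
rewrite (le_trans _ (le_trans (ler_norm _) (normc_ge_abs_Re _)))// ReG.
rewrite -lee_fin fineK; last exact: integrable_fin_num.
have -> : (partial_sum
    (fun i => normc (lam i * voice phi (ip (psi (pt i))) x)) J)%:E =
    (\int[mu]_y \sum_(i <- J) (c i * \1_(U i) y)%:E)%E.
  rewrite ge0_integral_sum//; last 2 first.
  - by move=> i; apply/measurable_EFinP/measurable_funM.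
  - by move=> i y _; rewrite lee_fin mulr_ge0.
  rewrite partial_sumE -sumEFin; apply: eq_bigr => i _.
  under eq_integral do rewrite EFinM.
  have mind : measurable_fun [set: borel X] (fun y => (\1_(U i) y)%:E : \bar R).
    by apply/measurable_EFinP; exact: measurable_indic.
  rewrite (ge0_integralZl mu measurableT mind) ?lee_fin//.
  rewrite integral_indic// setIT.
  rewrite -(fineK (cell_measure_fin mu_radon U_admissible i)).
  by rewrite -EFinM divfK// gt_eqF// cell_measure_gt0.
apply: ae_ge0_le_integral => //.
- by move=> y _; apply: sume_ge0 => i _; rewrite lee_fin mulr_ge0.
- apply: emeasurable_sum => i.
  by apply/measurable_EFinP/measurable_funM => //; exact: measurable_indic.
- by move=> y _; rewrite lee_fin.
- exact: (measurable_int mu iRe).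
move: KUx; apply: (@filterS _ _ (ae_filter_ringOfSetsType mu)) => y lty _.
rewrite sumEFin lee_fin Re_mulc /= mul0r subr0.
apply: le_trans (ler_wpM2l _ (partial_sum_le_natural_fun lam y J)); last first.
  by rewrite fine_ge0 ?sup_kernel_ge0.
rewrite partial_sumE mulr_sumr ler_sum// => i _.
rewrite /natural_term /c Normc.normcM indicE.
have [/set_mem Uiy|_] := boolP (y \in U i); last by rewrite !mulr0.
rewrite !mulr1 mulrA ler_wpM2r ?invr_ge0 ?fine_ge0//.
rewrite mulrC ler_wpM2r ?normc_ge0//.
rewrite /voice ip_conj normc_conj -lee_fin.
rewrite fineK ?ge0_fin_numE ?sup_kernel_ge0//.
exact: sup_kernel_ge.
Qed.

End natural_space.

(** * Convergence of the synthesis series *)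

Section H1_space.
Context (R : realType) (H : completeNormedModType R[i]).
Variable ip : {dot H for (@conjc R)}.
Context (X : ptopologicalType) (mu : {measure set (borel X) -> \bar R}).
Variable phi : X -> H.
Hypothesis phi_frame : parseval_frame ip mu phi.
Variable nu : X -> R.
Hypothesis nu_weight : weight nu.

Lemma H1_linear_closed (a : R[i]) u v :
  H1 ip mu phi nu u -> H1 ip mu phi nu v ->
  H1 ip mu phi nu (a *: u + v).
Proof.
have nu0 x : 0 <= nu x by rewrite (le_trans ler01)// nu_weight.2.
have mVnu h : measurable_fun [set: borel X]
    (fun x => (normc (voice phi (ip h) x) * nu x)%:E).
  apply/measurable_EFinP/measurable_funM; last exact: nu_weight.1.
  exact: (measurable_normc_voice phi_frame).
have Vnu0 h x : 0 <= normc (voice phi (ip h) x) * nu x.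
  by rewrite mulr_ge0 ?normc_ge0.
rewrite /H1 /wLp /= -!/(H1norm ip mu phi nu _) => -[_ Hu] [_ Hv].
split; first exact: (voice_cmeasurable phi_frame).
move: Hu Hv; rewrite !H1normE// => Hu Hv.
apply: (@le_lt_trans _ _ (\int[mu]_x
  ((normc a)%:E * (normc (voice phi (ip u) x) * nu x)%:E +
    (normc (voice phi (ip v) x) * nu x)%:E))%E).
  apply: ge0_le_integral => //.
  - by move=> x _; rewrite lee_fin.
  - by apply: emeasurable_funD => //; apply: measurable_funeM.
  - move=> x _; rewrite -EFinM -EFinD lee_fin mulrA -mulrDl ler_wpM2r//.
    by rewrite /voice ipDl ipZl -Normc.normcM le_normcD.
rewrite ge0_integralD//; last 3 first.
- by move=> x _; rewrite mule_ge0// lee_fin ?normc_ge0.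
- exact: measurable_funeM.
- by move=> x _; rewrite lee_fin.
rewrite ge0_integralZl// ?lee_fin ?normc_ge0//; last first.
  by move=> x _; rewrite lee_fin.
by rewrite lte_add_pinfty// lte_mul_pinfty// lee_fin normc_ge0.
Qed.

End H1_space.

Definition truncation (R : realType) (I : choiceType) (lam : I -> R[i])
  (J : {fset I}) (i : I) : R[i] := if i \in J then lam i else 0.

Section synthesis.
Context (R : realType) (H : completeNormedModType R[i]).
Variable ip : {dot H for (@conjc R)}.
Hypothesis ip_norm : forall f : H, `|f| ^+ 2 = ip f f.
Context (X : ptopologicalType) (mu : {measure set (borel X) -> \bar R}).
Hypothesis X_sigma_compact : sigma_compact X.
Hypothesis mu_radon : radon_measure mu.
Hypothesis mu_supp : supp mu = [set: X].
Variable phi : X -> H.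
Hypothesis phi_frame : parseval_frame ip mu phi.
Variable nu : X -> R.
Hypothesis nu_weight : weight nu.
Hypothesis phi_H1 : forall x, H1 ip mu phi nu (phi x).
Variable Y : qbfSpace mu.
Hypothesis Y_solid : solid Y.
Hypothesis phi_F : property_F ip phi nu Y.
Variable psi : X -> H.
Context (I : choiceType) (U : I -> set X).
Hypothesis U_admissible : admissible_covering U.
Hypothesis KU_finite : {ae mu, forall x, {ae mu, forall y,
  (sup_kernel U ip psi phi x y < +oo)%E}}.

Let KU x y : R[i] := (fine (sup_kernel U ip psi phi x y))%:C.

Hypothesis KU_bounded : kernel_bounded Y KU.
Variable pt : I -> X.
Hypothesis pt_U : forall i, U i (pt i).

Local Notation S lam := (partial_sum (fun i => lam i *: psi (pt i))).

Lemma ip_synthesis (lam : I -> R[i]) J z :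
  ip (S lam J) z = partial_sum (fun i => lam i * ip (psi (pt i)) z) J.
Proof.
rewrite !partial_sumE ip_suml; apply: eq_bigr => i _; exact: ipZl.
Qed.

(** One function [G] dominates the partial sums over all finite index sets, with
    phases inserted at will; this is what makes the later estimates uniform. *)
Lemma kernel_dominates lam : natural_space U Y lam ->
  exists G, [/\ qmem Y G,
    qnorm Y G <= kernel_opnorm Y KU * natural_norm U Y lam &
    {ae mu, forall x, forall J,
      partial_sum (fun i => normc (lam i * voice phi (ip (psi (pt i))) x)) J <=
      normc (G x)}].
Proof.
move=> Ylam; have [_ /(_ _ Ylam)[G [YG KG _]]] := KU_bounded.
exists G; split=> //.
  exact: (qnorm_le_kernel_opnorm KU_bounded Ylam YG KG).
exact: (partial_sum_voice_le_kernel mu_radon mu_supp U_admissible pt_U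
  KU_finite KG).
Qed.

(** Inserting phases turns the estimate of the pairing with [z] into an estimate
    of the sum of the absolute values of its terms. *)
Lemma synthesis_abs_le lam : natural_space U Y lam ->
  exists2 C : R, 0 <= C & forall z J,
    ((partial_sum (fun i => normc (lam i * ip (psi (pt i)) z)) J)%:E <=
     C%:E * H1norm ip mu phi nu z)%E.
Proof.
move=> /kernel_dominates[G [YG _ KG]].
have [C C0 CP] := property_F_Re_ip_le ip_norm phi_frame nu_weight phi_F.
have qG0 : 0 <= qnorm Y G by exact: qnorm_ge0.
exists (C * qnorm Y G) => [|z J]; first by rewrite mulr_ge0.
have /choice[a aP] i : exists a : R[i],
    normc a = 1 /\ a * (lam i * ip (psi (pt i)) z) =
    (normc (lam i * ip (psi (pt i)) z))%:C.
  by have [a] := phase_exists (lam i * ip (psi (pt i)) z); exists a.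
pose h := S (fun i => a i * lam i) J.
have Reh : Re (ip h z) =
    partial_sum (fun i => normc (lam i * ip (psi (pt i)) z)) J.
  rewrite /h ip_synthesis Re_partial_sum !partial_sumE.
  by apply: eq_bigr => i _; rewrite -mulrA (aP i).2.
have [Yh le_h] : qmem Y (voice phi (ip h)) /\
    qnorm Y (voice phi (ip h)) <= qnorm Y G.
  apply: Y_solid => //; first exact: (voice_cmeasurable phi_frame).
  move: KG; apply: (@filterS _ _ (ae_filter_ringOfSetsType mu)) => x /(_ J).
  apply: le_trans; rewrite /voice /h ip_synthesis.
  rewrite (le_trans (normc_partial_sum _ _))// !partial_sumE ler_sum// => i _.
  by rewrite -mulrA Normc.normcM (aP i).1 mul1r.
rewrite -Reh (le_trans (CP h z Yh))// lee_wpmul2r//; first exact: H1norm_ge0.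
by rewrite lee_fin ler_wpM2l.
Qed.

Lemma synthesis_weak_star_cvg lam : natural_space U Y lam ->
  exists f, weak_star_cvg ip mu phi nu totally (fun J => ip (S lam J)) f.
Proof.
move=> /synthesis_abs_le[C C0 CP].
suff /choice[f fP] : forall z, exists l : R[i], H1 ip mu phi nu z ->
    (fun J => ip (S lam J) z) @ totally --> (l : R[i]^o) by exists f.
move=> z; have [[_ z_lty]|] := pselect (H1 ip mu phi nu z); last by exists 0.
have z_fin : H1norm ip mu phi nu z \is a fin_num.
  by rewrite ge0_fin_numE//; exact: H1norm_ge0.
have [|l lP] := @partial_sum_complex_cvg _ _
    (fun i => lam i * ip (psi (pt i)) z) (C * fine (H1norm ip mu phi nu z)).
  by move=> J; rewrite -lee_fin EFinM fineK.
exists l => _; rewrite (_ : (fun J => ip (S lam J) z) =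
  partial_sum (fun i => lam i * ip (psi (pt i)) z))//.
by apply/funext => J; rewrite ip_synthesis.
Qed.

(** The existence of the limit is a hypothesis here, so that the same statement
    covers the whole series, its partial sums and its remainders. *)
Lemma weak_star_cvg_Co lam f : natural_space U Y lam ->
  weak_star_cvg ip mu phi nu totally (fun J => ip (S lam J)) f ->
  Co ip phi nu Y f /\
  Co_norm phi Y f <= kernel_opnorm Y KU * natural_norm U Y lam.
Proof.
move=> Ylam lamf.
have [G [YG le_G KG]] := kernel_dominates Ylam.
have mf : cmeasurable (voice phi f : borel X -> R[i]).
  have Xc := admissible_countable U_admissible X_sigma_compact.
  split.
  - apply: (@measurable_fun_totally_cvg R I _ (borel X)
      (fun J x => Re (voice phi (ip (S lam J)) x))) => // [J|x].
      exact: (voice_cmeasurable phi_frame _).1.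
    exact: ((cvg_complexP _ _).1 (lamf _ (phi_H1 x))).1.
  - apply: (@measurable_fun_totally_cvg R I _ (borel X)
      (fun J x => Im (voice phi (ip (S lam J)) x))) => // [J|x].
      exact: (voice_cmeasurable phi_frame _).2.
    exact: ((cvg_complexP _ _).1 (lamf _ (phi_H1 x))).2.
have [Yf le_f] : qmem Y (voice phi f) /\ qnorm Y (voice phi f) <= qnorm Y G.
  apply: Y_solid => //.
  move: KG; apply: (@filterS _ _ (ae_filter_ringOfSetsType mu)) => x KGx.
  apply: (normc_lim_le (lamf _ (phi_H1 x))); apply: nearW => J.
  by rewrite ip_synthesis (le_trans (normc_partial_sum _ _)).
split; last exact: le_trans le_f le_G.
split=> //; split.
  move=> a u v Hu Hv.
  apply: (@cvg_unique _ (@norm_hausdorff R[i] R[i]^o) _ _ _ _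
    (lamf _ (H1_linear_closed phi_frame nu_weight a Hu Hv))).
  rewrite (_ : (fun J => _) =
      fun J => conjc a * ip (S lam J) u + ip (S lam J) v); last first.
    by apply/funext => J; rewrite ipDr ipZr.
  apply: (@cvgD R[i] R[i]^o); last exact: lamf.
  by apply: (@cvgMr R[i]); exact: lamf.
have [C C0 CP] := synthesis_abs_le Ylam.
exists C => z Hz; have z_fin : H1norm ip mu phi nu z \is a fin_num.
  by rewrite ge0_fin_numE ?H1norm_ge0//; exact: Hz.2.
rewrite -(fineK z_fin) -EFinM lee_fin.
apply: (normc_lim_le (lamf _ Hz)); apply: nearW => J.
rewrite ip_synthesis (le_trans (normc_partial_sum _ _))//.
by rewrite -lee_fin EFinM fineK.
Qed.

Lemma synthesis_truncation lam (J K : {fset I}) : (J `<=` K)%fset ->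
  S (truncation lam J) K = S lam J.
Proof.
move=> JK; rewrite !partial_sumE -(big_fset_incl _ JK).
  rewrite big_seq [RHS]big_seq; apply: eq_bigr => i iJ.
  by rewrite /truncation iJ.
by move=> i _ iNJ; rewrite /truncation (negbTE iNJ) scale0r.
Qed.

Lemma Co_partial_synthesis lam J : natural_space U Y lam ->
  Co ip phi nu Y (ip (S lam J)).
Proof.
move=> Ylam; pose lamJ := truncation lam J.
have [YlamJ _] : natural_space U Y lamJ /\
    natural_norm U Y lamJ <= natural_norm U Y lam.
  apply: (natural_space_solid X_sigma_compact U_admissible Y_solid Ylam) => i.
  rewrite /lamJ /truncation; case: ifP => // _.
  by rewrite Normc.normc0 normc_ge0.
apply: (weak_star_cvg_Co YlamJ _).1 => z _.
apply: (@cvg_near_cst _ R[i]^o).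
by apply/near_totallyP; exists J => J' /synthesis_truncation ->.
Qed.

(** Up to sign, the remainder is itself a synthesis series: its coefficients
    vanish on [J], and outside of [J] they agree with those of the difference
    between [lam] and any sequence supported in [J]. *)
Lemma Co_norm_remainder_le lam lam' f J : natural_space U Y lam ->
  natural_space U Y lam' -> (forall i, i \notin J -> lam' i = 0) ->
  weak_star_cvg ip mu phi nu totally (fun J => ip (S lam J)) f ->
  0 <= Co_norm phi Y (fun z => ip (S lam J) z - f z) <=
    kernel_opnorm Y KU * natural_norm U Y (fun i => lam i - lam' i).
Proof.
move=> Ylam Ylam' lam'0 lamf.
pose tail i := truncation lam J i - lam i.
have [Ytail le_tail] : natural_space U Y tail /\
    natural_norm U Y tail <= natural_norm U Y (fun i => lam i - lam' i).
  apply: (natural_space_solid X_sigma_compact U_admissible Y_solid).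
    exact: (natural_spaceB X_sigma_compact U_admissible Y_solid Ylam Ylam').
  move=> i; rewrite /tail /truncation; case: ifPn => [_|/lam'0 ->].
    by rewrite subrr Normc.normc0 normc_ge0.
  by rewrite sub0r subr0 normcN.
have tail_cvg : weak_star_cvg ip mu phi nu totally (fun K => ip (S tail K))
    (fun z => ip (S lam J) z - f z).
  move=> z Hz.
  have -> : (fun K => ip (S tail K) z) =
      fun K => ip (S (truncation lam J) K) z - ip (S lam K) z.
    apply/funext => K; rewrite -ipBl; congr (ip _ z).
    by rewrite !partial_sumE -sumrB; apply: eq_bigr => i _; rewrite scalerBl.
  apply: (@cvgB R[i] R[i]^o); last exact: lamf.
  apply: (@cvg_near_cst _ R[i]^o).
  by apply/near_totallyP; exists J => K /synthesis_truncation ->.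
have [[_ Yrem] le_rem] := weak_star_cvg_Co Ytail tail_cvg.
rewrite qnorm_ge0//= (le_trans le_rem)// ler_wpM2l//.
exact: kernel_opnorm_ge0.
Qed.

Lemma synthesis_quasi_norm_cvg lam f : finite_sequences_dense U Y ->
  natural_space U Y lam ->
  weak_star_cvg ip mu phi nu totally (fun J => ip (S lam J)) f ->
  (fun J => Co_norm phi Y (fun z => ip (S lam J) z - f z)) @ totally
    --> (0 : R).
Proof.
move=> dense Ylam lamf; apply/(@cvgrPdist_lt R R^o) => e e0.
have C0 := kernel_opnorm_ge0 Y KU; set C := kernel_opnorm Y KU in C0 *.
(* [C] may vanish, so the tolerance is divided by [C + 1] instead of [C]. *)
have C1_gt0 : 0 < C + 1 by rewrite ltr_wpDl.
have [lam' [fin_lam' Ylam' lt_lam']] := dense _ Ylam _ (divr_gt0 e0 C1_gt0).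
apply/near_totallyP; exists (fset_set [set i | lam' i != 0]) => J suppJ.
have lam'0 i : i \notin J -> lam' i = 0.
  apply: contraNeq => lam'i; apply: (fsubsetP suppJ).
  by rewrite in_fset_set// inE.
have /andP[rem0 le_rem] := Co_norm_remainder_le Ylam Ylam' lam'0 lamf.
have norm0 : 0 <= natural_norm U Y (fun i => lam i - lam' i).
  apply: qnorm_ge0.
  exact: (natural_spaceB X_sigma_compact U_admissible Y_solid Ylam Ylam').
rewrite sub0r normrN ger0_norm// (le_lt_trans le_rem)//.
rewrite (@le_lt_trans _ _ ((C + 1) *
    natural_norm U Y (fun i => lam i - lam' i)))//.
  by rewrite ler_wpM2r// lerDl.
by rewrite mulrC -ltr_pdivlMr.
Qed.

End synthesis.

Theorem lemma2p40 (R : realType)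
  (H : completeNormedModType R[i]) (ip : {dot H for (@conjc R)})
  (ip_norm : forall f : H, `|f| ^+ 2 = ip f f)
  (H_separable : separable H)
  (X : ptopologicalType) (X_sigma_compact : sigma_compact X)
  (X_locally_compact : locally_compact [set: X])
  (X_hausdorff : hausdorff_space X)
  (mu : {measure set (borel X) -> \bar R})
  (mu_radon : radon_measure mu) (mu_supp : supp mu = [set: X])
  (phi : X -> H) (phi_frame : parseval_frame ip mu phi)
  (nu : X -> R) (nu_weight : weight nu)
  (phi_H1 : forall x, H1 ip mu phi nu (phi x))
  (Y : qbfSpace mu) (Y_solid : solid Y) (Y_rich : rich Y)
  (phi_F : property_F ip phi nu Y)
  (psi : X -> H)
  (I : choiceType) (U : I -> set X) (U_admissible : admissible_covering U)
  (KU_finite : {ae mu, forall x, {ae mu, forall y,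
     (sup_kernel U ip psi phi x y < +oo)%E}})
  (KU := fun x y => (fine (sup_kernel U ip psi phi x y))%:C : R[i])
  (KU_bounded : kernel_bounded Y KU)
  (lam : I -> R[i]) (lam_natural : natural_space U Y lam)
  (pt : I -> X) (pt_U : forall i, U i (pt i)) :
  let S : {fset I} -> H := partial_sum (fun i => lam i *: psi (pt i)) in
  exists f : H -> R[i],
    [/\ weak_star_cvg ip mu phi nu totally (fun J => ip (S J)) f,
        Co ip phi nu Y f,
        forall x, partial_sum (fun i => lam i * voice phi (ip (psi (pt i))) x)
                    @ totally --> (voice phi f x : R[i]^o),
        Co_norm phi Y f <= kernel_opnorm Y KU * natural_norm U Y lam &
        finite_sequences_dense U Y ->
          (forall J, Co ip phi nu Y (ip (S J))) /\
          (fun J => Co_norm phi Y (fun z => ip (S J) z - f z)) @ totally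
            --> (0 : R)].
Proof.
move=> S.
have [f lamf] := synthesis_weak_star_cvg ip_norm mu_radon mu_supp phi_frame
  nu_weight Y_solid phi_F U_admissible KU_finite KU_bounded pt_U lam_natural.
have [Cof le_f] := weak_star_cvg_Co ip_norm X_sigma_compact mu_radon
  mu_supp phi_frame nu_weight phi_H1 Y_solid phi_F U_admissible KU_finite
  KU_bounded pt_U lam_natural lamf.
exists f; split=> // [x|dense].
  rewrite (_ : partial_sum _ = fun J => ip (S J) (phi x)); first exact: lamf.
  by apply/funext => J; rewrite ip_synthesis.
split=> [J|].
  exact: (Co_partial_synthesis ip_norm X_sigma_compact mu_radon
    mu_supp phi_frame nu_weight phi_H1 Y_solid phi_F U_admissible KU_finite
    KU_bounded pt_U J lam_natural).
exact: (synthesis_quasi_norm_cvg ip_norm X_sigma_compact mu_radon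
  mu_supp phi_frame nu_weight phi_H1 Y_solid phi_F U_admissible KU_finite
  KU_bounded pt_U dense lam_natural lamf).
Qed.
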